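(* Let $\mathcal{J}$ be a set of $n$ jobs with ending times upper-bounded by $N$ (unit rewards). For any $\varepsilon > 0$, there exists a local computation algorithm for $(1+\varepsilon)$-approximate unweighted interval scheduling of $\mathcal{J}$ on a single machine that uses $O\left(\frac{\log N}{\varepsilon}\right)$ probes per query.
   Context: Each job $j$ is a time interval $[s_j,s_j+l_j]$ with $s_j\ge 0$, $l_j\ge1$, $s_j+l_j\le N$; a feasible single-machine schedule is a set of pairwise non-overlapping jobs; the goal is to maximize the number of scheduled jobs; a solution is $(1+\varepsilon)$-approximate if its size is at least $1/(1+\varepsilon)$ times the optimum. Local computation algorithm (LCA): the algorithm does not read the whole input; it has probe access to a successor oracle which, on probe $successor(x)$, returns the job with the earliest ending time among the jobs that start after time $x$. On a query job $I\in\mathcal{J}$ the LCA must answer whether $I$ is in the solution, and all answers (for a fixed $\varepsilon$) must be consistent with one single $(1+\varepsilon)$-approximate feasible solution. The complexity measure is the number of oracle probes per query. *)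

(* Defs.v *)
From mathcomp Require Import all_boot all_order all_algebra finmap.
From mathcomp Require Import reals exp.

Set Implicit Arguments.
Unset Strict Implicit.
Unset Printing Implicit Defensive.

Import Order.TTheory GRing.Theory Num.Theory.

Local Open Scope fset_scope.
Local Open Scope ring_scope.

(* (a, (s, l)) is the job [s, s + l] carrying the label a.  Labels let two     *)
(* distinct jobs occupy the same interval; with K := unit a job is nothing     *)
(* but its interval.                                                           *)
Definition job (K : choiceType) (R : realType) : Type := (K * (R * R))%type.

Section IntervalScheduling.
Variables (K : choiceType) (R : realType).
Implicit Types (j : job K R) (J S : {fset job K R}).

Definition start j : R := j.2.1.
Definition len j : R := j.2.2.
Definition finish j : R := start j + len j.

Definition valid_jobs (N : R) J : Prop :=
  forall j, j \in J -> [/\ 0 <= start j, 1 <= len j & finish j <= N].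

(* Jobs are closed intervals, so jobs sharing an endpoint overlap; this goes   *)
(* with the strict inequality in is_successor.                                 *)
Definition non_overlapping i j : bool :=
  (finish i < start j) || (finish j < start i).

Definition feasible S : bool :=
  [forall i : S, forall j : S, (i != j) ==> non_overlapping (val i) (val j)].

Definition opt J : nat := \max_(S <- fpowerset J | feasible S) #|` S|.

Definition approx_solution (eps : R) J S : Prop :=
  [/\ S `<=` J, feasible S & (1 + eps)^-1 * (opt J)%:R <= #|` S|%:R].

(* Ties between equal ending times are broken arbitrarily by the oracle.       *)
Definition is_successor J (succ : R -> option (job K R)) : Prop :=
  forall x : R,
    match succ x with
    | Some j => [/\ j \in J, x < start j &
                    forall i, i \in J -> x < start i -> finish j <= finish i]
    | None => forall i, i \in J -> ~~ (x < start i)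
    end.

(* The computation on one query: an adaptive sequence of probes to the         *)
(* successor oracle, ending with a yes/no answer.                              *)
Inductive computation : Type :=
| Answer of bool
| Probe of R & (option (job K R) -> computation).

Fixpoint answer (succ : R -> option (job K R)) (c : computation) : bool :=
  match c with
  | Answer b => b
  | Probe x next => answer succ (next (succ x))
  end.

Fixpoint probes (succ : R -> option (job K R)) (c : computation) : nat :=
  match c with
  | Answer _ => 0
  | Probe x next => (probes succ (next (succ x))).+1
  end.

(* An LCA sees the queried job only; it holds no state between queries.        *)
Definition lca : Type := job K R -> computation.

Definition approx_lca (N eps q : R) (A : lca) : Prop :=
  forall J succ, valid_jobs N J -> is_successor J succ ->
    (exists2 S, approx_solution eps J S &
       forall I, I \in J -> answer succ (A I) = (I \in S)) /\
    (forall I, I \in J -> (probes succ (A I))%:R <= q).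

End IntervalScheduling.

(* Main.v *)
Require Import Defs.
From mathcomp Require Import all_boot all_order all_algebra finmap.
From mathcomp Require Import reals exp.
From mathcomp Require Import zify ring lra.

Import Order.TTheory GRing.Theory Num.Theory.
Local Open Scope ring_scope.

(** The earliest-finish greedy solution of a window is optimal, but following
    it from the left end of the timeline is too expensive, so the timeline is
    cut into segments that are solved separately.  With [k] about [1 / eps],
    a binary search keeps a current segment [(a, b]] and a cell [(u, v]] such
    that [(a, u]] and [(v, b]] both contain fewer than [k] greedy jobs.  The
    midpoint [m] of the cell becomes a cut only if both [(a, m]] and [(m, b]]
    contain at least [k] greedy jobs; otherwise the cell is halved and the
    segment is kept.  A cut destroys at most one job of an optimal solution,
    and every segment it creates has at least [k] jobs, so the loss is at most
    a fraction [1 / k].  After about [log2 N] halvings no job fits in the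
    cell, hence the segment has at most [2 k] jobs and [2 k + 1] greedy steps
    solve it.  Each halving costs [2 k] probes. *)

Section Algorithm.
Context {K : choiceType} {R : realType}.
Implicit Types (i j I : job K R) (J : {fset job K R}) (s T : seq (job K R)).
Implicit Types (a b m u v x : R) (succ : R -> option (job K R)).

(** * Greedy runs, the segmented solution and its query form *)

Definition inside a b i : bool := (a < start i) && (finish i <= b).

Definition before i j : bool := finish i < start j.

(** [f] is fuel: a result shorter than [f] certifies that the run ended by itself, so it is
    complete. *)
Fixpoint greedy succ (f : nat) b x : seq (job K R) :=
  if f is f'.+1 then
    if succ x is Some j then
      if finish j <= b then j :: greedy succ f' b (finish j) else [::]
    else [::]
  else [::].

Fixpoint segmented succ (k d : nat) a b u v : seq (job K R) :=
  if d is d'.+1 then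
    let m := (u + v) / 2 in
    if (size (greedy succ k m a) < k)%N then segmented succ k d' a b m v
    else if (size (greedy succ k b m) < k)%N then segmented succ k d' a b u m
    else segmented succ k d' a m u m ++ segmented succ k d' m b m v
  else greedy succ k.*2.+1 b a.

(** Continuation-passing form: a probe tree must nest whatever follows a run, passed here as
    [next]. *)
Fixpoint greedy_then (f : nat) b x
    (next : seq (job K R) -> computation K R) : computation K R :=
  if f is f'.+1 then
    Probe x (fun o => if o is Some j then
        if finish j <= b
        then greedy_then f' b (finish j) (fun s => next (j :: s))
        else next [::]
      else next [::])
  else next [::].

(** At a cut only the side that can contain [I] is followed, so the cost grows with the depth and
    not with the number of segments. *)
Fixpoint segmented_query (k d : nat) a b u v I : computation K R :=
  if d is d'.+1 then
    let m := (u + v) / 2 in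
    greedy_then k m a (fun s =>
      if (size s < k)%N then segmented_query k d' a b m v I else
      greedy_then k b m (fun s' =>
        if (size s' < k)%N then segmented_query k d' a b u m I
        else if finish I <= m then segmented_query k d' a m u m I
        else segmented_query k d' m b m v I))
  else greedy_then k.*2.+1 b a (fun s => Answer K R (I \in s)).

(** * Answers and probe counts of the query form *)

Lemma answer_greedy_then succ f b x next :
  answer succ (greedy_then f b x next) = answer succ (next (greedy succ f b x)).
Proof.
elim: f x next => [|f IH] x next //=.
by case: (succ x) => [j|] //; case: ifP => // _; rewrite IH.
Qed.

Lemma probes_greedy_then succ f b x next :
  (probes succ (greedy_then f b x next)
     <= f + probes succ (next (greedy succ f b x)))%N.
Proof.
elim: f x next => [|f IH] x next //=.
rewrite addSn ltnS.
case: (succ x) => [j|]; last exact: leq_addl.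
by case: ifP => _; [exact: IH | exact: leq_addl].
Qed.

Lemma probes_segmented_query succ k d a b u v I :
  (probes succ (segmented_query k d a b u v I) <= d * k.*2 + k.*2.+1)%N.
Proof.
elim: d a b u v => [|d IH] a b u v.
  have := probes_greedy_then succ k.*2.+1 b a (fun s => Answer K R (I \in s)).
  by move/leq_trans; apply; rewrite addn0.
rewrite /=; set m := (u + v) / 2; apply: leq_trans (probes_greedy_then _ _ _ _ _) _.
case: ifP => _; first by have := IH a b m v; lia.
suff: (forall c, probes succ (c (greedy succ k b m)) <= d * k.*2 + k.*2.+1 ->
        k + probes succ (greedy_then k b m c) <= d.+1 * k.*2 + k.*2.+1)%N.
  by apply; case: ifP => _ //; case: ifP.
by move=> c hc; have := probes_greedy_then succ k b m c; lia.
Qed.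

(** * Counting disjoint jobs around a point *)

Definition stabbed x i : bool := (start i <= x) && (x <= finish i).

Lemma count_stabbed T x :
  pairwise (fun i j => non_overlapping i j) T -> (count (stabbed x) T <= 1)%N.
Proof.
elim: T => //= i T IH /andP[/allP nT /IH {}IH].
case: (boolP (stabbed x i)) => [/andP[si fi]|_]; last by rewrite add0n.
rewrite add1n ltnS leqNgt -has_count.
apply/hasPn => j /nT; rewrite /non_overlapping.
by case/orP => h; apply/negP => /andP[sj fj]; lra.
Qed.

(** At most one job of [T] contains [x], whence the [+ 1]. Serves both the cuts and the greedy
    exchange argument. *)
Lemma count_le_stabbed (P Q : pred (job K R)) T x :
  pairwise (fun i j => non_overlapping i j) T ->
  {in T, forall i, P i -> Q i || stabbed x i} ->
  (count P T <= count Q T + 1)%N.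
Proof.
move=> nT h; apply: leq_trans (leq_add (leqnn _) (count_stabbed T x nT)).
elim: T h {nT} => //= i T IH h.
have {}IH : (count P T <= count Q T + count (stabbed x) T)%N.
  by apply: IH => j jT; apply: h; rewrite inE jT orbT.
have := h i (mem_head _ _); move: (P i) (Q i) (stabbed x i) => [] [] [] //=;
  by [lia | move/(_ isT)].
Qed.

Lemma count_inside_cut T a b x :
  pairwise (fun i j => non_overlapping i j) T ->
  (count (inside a b) T
     <= count (inside a x) T + count (inside x b) T + 1)%N.
Proof.
move=> nT; rewrite -count_predUI.
have h : (count (inside a b) T <= count (predU (inside a x) (inside x b)) T + 1)%N.
  apply: (count_le_stabbed _ _ _ x nT) => i _ /andP[ai ib].
  rewrite /= /inside /stabbed ai ib andbT /=.
  by case: (leP (finish i) x) => // /ltW ->; case: (leP (start i) x).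
by apply: leq_trans h _; lia.
Qed.

(** * Feasible sets as pairwise disjoint lists *)

Lemma feasibleP (S : {fset job K R}) :
  reflect {in S &, forall i j, i != j -> non_overlapping i j} (feasible S).
Proof.
apply: (iffP forallP) => [h i j iS jS ij|h i].
  by have /forallP/(_ [` jS]%fset)/implyP := h [` iS]%fset; apply.
apply/forallP => j; apply/implyP => ij.
by apply: h; rewrite ?fsvalP ?(inj_eq val_inj).
Qed.

Lemma feasible_pairwise (S : {fset job K R}) :
  feasible S -> pairwise (fun i j => non_overlapping i j) S.
Proof.
move=> /feasibleP hS; have := fset_uniq S; rewrite uniq_pairwise.
by apply: (sub_in_pairwise (P := mem S)) => //; apply/allP.
Qed.

Lemma pairwise_feasible T :
  pairwise (fun i j => non_overlapping i j) T -> feasible [fset i in T]%fset.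
Proof.
move=> nT; apply/feasibleP => i j; rewrite !inE.
elim: T nT => //= t T IH /andP[/allP ht /IH {}IH]; rewrite !inE.
case/predU1P => [->|iT] /predU1P[->|jT]; rewrite ?eqxx //.
- by move=> _; apply: ht.
- by move=> _; rewrite /non_overlapping orbC; apply: ht.
- exact: IH.
Qed.

Lemma before_non_overlapping T :
  pairwise before T -> pairwise (fun i j => non_overlapping i j) T.
Proof. by apply: sub_pairwise => i j ij; apply/orP; left. Qed.

(** * Greedy runs under a correct oracle *)

Section Oracle.
Context (J : {fset job K R}) (N : R) (succ : R -> option (job K R)).
Hypotheses (hJ : valid_jobs N J) (hsucc : is_successor J succ).

Lemma start_lt_finish i : i \in J -> start i < finish i.
Proof. by move/hJ => [_ hl _]; rewrite /finish; lra. Qed.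

Lemma greedy_sub f b x : {subset greedy succ f b x <= J}.
Proof.
elim: f x => [|f IH] x //=.
have := hsucc x; case: (succ x) => [j [jJ _ _]|_] //; case: ifP => // _ i.
by rewrite inE => /predU1P[->|/IH].
Qed.

Lemma greedy_inside f b x : all (inside x b) (greedy succ f b x).
Proof.
elim: f x => [|f IH] x //=.
have := hsucc x; case: (succ x) => [j [jJ xj _]|_] //; case: ifP => // fj /=.
rewrite {1}/inside xj fj /=; apply: sub_all (IH _) => i /andP[h1 h2].
by rewrite /inside h2 andbT; have := start_lt_finish _ jJ; lra.
Qed.

Lemma greedy_pairwise f b x : pairwise before (greedy succ f b x).
Proof.
elim: f x => [|f IH] x //=.
case: (succ x) => [j|] //; case: ifP => // fj /=.
by rewrite IH andbT; apply: sub_all (greedy_inside _ _ _) => i /andP[].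
Qed.

(* Every job of [T] in the window either lies to the right of the first greedy
   job or contains the finish time of that job. *)
Lemma greedy_optimal f b x T :
  {subset T <= J} -> pairwise (fun i j => non_overlapping i j) T ->
  (size (greedy succ f b x) < f)%N ->
  (count (inside x b) T <= size (greedy succ f b x))%N.
Proof.
move=> TJ nT; elim: f x => [|f IH] x //=.
have := hsucc x; case: (succ x) => [j [jJ xj hj]|hx]; last first.
  move=> _; rewrite leqNgt -has_count; apply/hasPn => i /TJ iJ.
  by rewrite /inside (negbTE (hx i iJ)).
case: ifP => fj /=; last first.
  move=> _; rewrite leqNgt -has_count; apply/hasPn => i /TJ iJ.
  apply/negP => /andP[xi fi]; have := hj i iJ xi; move/negbT: fj; lra.
rewrite ltnS => /IH {}IH.
rewrite -addn1 (leq_trans _ (leq_add IH (leqnn 1))) //.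
apply: (count_le_stabbed _ _ _ (finish j) nT) => i /TJ iJ /andP[xi ib].
by rewrite /inside /stabbed ib (hj i iJ xi) !andbT; case: leP.
Qed.

Lemma inside_empty a b T :
  {subset T <= J} -> b - a <= 1 -> count (inside a b) T = 0%N.
Proof.
move=> TJ ba; apply/eqP; rewrite -leqn0 leqNgt -has_count; apply/hasPn => i /TJ.
move=> /hJ[_ hl _]; apply/negP => /andP[ai ib].
by move: ib; rewrite /finish; lra.
Qed.

Lemma count_greedy f b x :
  count (inside x b) (greedy succ f b x) = size (greedy succ f b x).
Proof. by apply/eqP; rewrite -all_count greedy_inside. Qed.

(** When an end of the cell is also an end of the segment, as at the start and after a cut, this
    gives that side of the invariant. *)
Lemma greedy_self_lt k a : (0 < k)%N -> (size (greedy succ k a a) < k)%N.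
Proof.
move=> k0; rewrite -count_greedy inside_empty ?subrr ?ler01 //.
exact: greedy_sub.
Qed.

(** * Feasibility, query answers and approximation ratio of the segmented solution *)

Lemma segmented_sub k d a b u v : {subset segmented succ k d a b u v <= J}.
Proof.
elim: d a b u v => [|d IH] a b u v; first exact: greedy_sub.
rewrite [segmented _ _ _ _ _ _ _]/=; do 2 (case: ifP => _; first exact: IH).
by move=> i; rewrite mem_cat => /orP[] /IH.
Qed.

(** The cell is not assumed to lie in the segment; this places a cut strictly between [a] and
    [b]. *)
Lemma greedy_gt0_lt f b x : (0 < size (greedy succ f b x))%N -> x < b.
Proof.
have := greedy_inside f b x; have := @greedy_sub f b x.
case: (greedy succ f b x) => // i s /(_ i (mem_head _ _)) /start_lt_finish h.
by move=> /andP[/andP[xi ib] _] _; lra.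
Qed.

Lemma segmented_inside k d a b u v : (0 < k)%N ->
  all (inside a b) (segmented succ k d a b u v).
Proof.
move=> k0; elim: d a b u v => [|d IH] a b u v; first exact: greedy_inside.
rewrite [segmented _ _ _ _ _ _ _]/=; set m := (u + v) / 2.
case: ifP => [_|/negbT]; first exact: IH.
rewrite -leqNgt => hl; case: ifP => [_|/negbT]; first exact: IH.
rewrite -leqNgt => hr.
have am := greedy_gt0_lt _ _ _ (leq_trans k0 hl).
have mb := greedy_gt0_lt _ _ _ (leq_trans k0 hr).
rewrite all_cat; apply/andP; split; apply: sub_all (IH _ _ _ _) => i /andP[h1 h2];
  by rewrite /inside; lra.
Qed.

Lemma segmented_pairwise k d a b u v : (0 < k)%N ->
  pairwise before (segmented succ k d a b u v).
Proof.
move=> k0; elim: d a b u v => [|d IH] a b u v; first exact: greedy_pairwise.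
rewrite [segmented _ _ _ _ _ _ _]/=; do 2 (case: ifP => _; first exact: IH).
rewrite pairwise_cat !IH !andbT; apply/allrelP => i j.
move=> /(allP (segmented_inside _ _ _ _ _ _ k0))/andP[_ h1].
move=> /(allP (segmented_inside _ _ _ _ _ _ k0))/andP[h2 _].
by rewrite /before; lra.
Qed.

Lemma segmented_uniq k d a b u v : (0 < k)%N ->
  uniq (segmented succ k d a b u v).
Proof.
move=> k0; have := segmented_pairwise k d a b u v k0; rewrite uniq_pairwise.
apply: (sub_in_pairwise (P := mem J)) => [i j iJ _ /= ij|].
  apply/eqP => e; move: ij; rewrite -e /before.
  by have := start_lt_finish _ iJ; lra.
by apply/allP; exact: segmented_sub.
Qed.

(** Jobs have positive length, so a job finishing by the cut [m] cannot start after it: comparing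
    [finish I] with [m] picks the only possible side. *)
Lemma answer_segmented_query k d a b u v I : (0 < k)%N -> I \in J ->
  answer succ (segmented_query k d a b u v I)
    = (I \in segmented succ k d a b u v).
Proof.
move=> k0 IJ; elim: d a b u v => [|d IH] a b u v.
  exact: (answer_greedy_then succ k.*2.+1 b a (fun s => Answer K R (I \in s))).
rewrite /=; set m := (u + v) / 2; rewrite answer_greedy_then; case: ifP => _ //.
rewrite answer_greedy_then; case: ifP => _ //; rewrite mem_cat.
case: leP => hm; rewrite IH.
  case: (I \in segmented succ k d a m u m) => //=; apply/esym/negP.
  move/(allP (segmented_inside _ _ _ _ _ _ k0))/andP => [h _].
  by have := start_lt_finish _ IJ; lra.
case: (boolP (I \in segmented succ k d a m u m)) => //.
by move/(allP (segmented_inside _ _ _ _ _ _ k0))/andP => [_ h]; lra.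
Qed.

(* The surplus [k] in the second clause pays for the job lost at the cut that
   created the segment. *)
Lemma segmented_approx k d a b u v T : (0 < k)%N ->
  {subset T <= J} -> pairwise (fun i j => non_overlapping i j) T ->
  (size (greedy succ k u a) < k)%N -> (size (greedy succ k b v) < k)%N ->
  v - u <= 2 ^+ d ->
  (k * count (inside a b) T <= k.+1 * size (segmented succ k d a b u v))%N /\
  ((k <= size (greedy succ k b a))%N ->
   (k * count (inside a b) T + k
      <= k.+1 * size (segmented succ k d a b u v))%N).
Proof.
move=> k0 TJ nT; elim: d a b u v => [|d IH] a b u v hl hr huv.
  rewrite expr0 in huv; rewrite [segmented _ _ _ _ _ _ _]/=.
  set G := greedy succ k.*2.+1 b a.
  have GJ : {subset G <= J} by exact: greedy_sub.
  have nG := before_non_overlapping _ (greedy_pairwise k.*2.+1 b a).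
  (* Split at [u] and [v]: at most [k - 1] jobs on each side, none in the cell, and one lost per
     split, hence at most [2 k]. *)
  have hG : (size G < k.*2.+1)%N.
    rewrite -[size G]count_greedy -/G.
    have h1 := count_inside_cut G a b u nG.
    have h2 := count_inside_cut G u b v nG.
    have h3 := inside_empty _ _ _ GJ huv.
    have h4 := greedy_optimal _ _ _ _ GJ nG hl.
    have h5 := greedy_optimal _ _ _ _ GJ nG hr.
    by lia.
  have h := greedy_optimal _ _ _ _ TJ nT hG.
  split=> [|hk]; first by rewrite leq_mul.
  (* The run with fuel [k] competes with [G], so [G] has at least [k] jobs; the extra [size G] then
     covers the surplus. *)
  have := greedy_optimal _ _ _ _ (@greedy_sub k b a)
    (before_non_overlapping _ (greedy_pairwise k b a)) hG.
  rewrite count_greedy => h'.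
  by rewrite mulSn addnC leq_add ?(leq_trans hk h') // leq_mul.
rewrite [segmented _ _ _ _ _ _ _]/=; set m := (u + v) / 2.
have hm1 : v - m <= 2 ^+ d by move: huv; rewrite exprS /m; lra.
have hm2 : m - u <= 2 ^+ d by move: huv; rewrite exprS /m; lra.
case: ifP => [hc|/negbT]; first exact: IH.
rewrite -leqNgt => hml; case: ifP => [hc|/negbT]; first exact: IH.
rewrite -leqNgt => hmr.
(* Of the two surpluses [k], one pays for the job lost at [m] and the other remains for [(a, b]]. *)
have [_ /(_ hml) h1] := IH a m u m hl (greedy_self_lt _ _ k0) hm2.
have [_ /(_ hmr) h2] := IH m b m v (greedy_self_lt _ _ k0) hr hm1.
have h3 := leq_mul (leqnn k) (count_inside_cut T a b m nT).
by rewrite size_cat; split=> [|_]; lia.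
Qed.

End Oracle.
End Algorithm.

(** * Choice of parameters and final bounds *)

Theorem theorem2 (R : realType) (E : R) (hE : 0 < E) :
  exists2 C : R, 0 < C &
    forall (K : choiceType) (N eps : R), 2 <= N -> 0 < eps -> eps <= E ->
      exists A : lca K R, approx_lca N eps (C * (ln N / eps)) A.
Proof.
have ln2 : 0 < ln 2 :> R by rewrite ln_gt0 // ltr1n.
(* From [d <= 3 * (ln N / ln 2)] and [1 <= k <= (1 + E) / eps], the count [2 k d + 2 k + 1] is at
   most 9 times the product of these scales; 10 leaves slack. *)
exists (10 * (1 + E) / ln 2); first by rewrite !mulr_gt0 ?invr_gt0 //; lra.
move=> K N eps hN he heE.
(* [1 / k <= eps] yields the ratio; [2 ^ d >= N + 1] covers the first cell [(-1, N]], which starts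
   below 0 because windows are open on the left. *)
pose k := (Num.truncn eps^-1).+1; pose d := (Num.truncn (ln (N + 1) / ln 2)).+1.
have ie0 : 0 < eps^-1 by rewrite invr_gt0.
have [k1 k2] : eps^-1 <= k%:R /\ k%:R <= eps^-1 + 1.
  have /andP[h1 h2] := truncn_itv (ltW ie0).
  by split; [exact: ltW | rewrite /k -natr1; lra].
have lnN : ln 2 <= ln N by rewrite ler_ln ?posrE //; lra.
have lnN1 : ln (N + 1) <= 2 * ln N.
  rewrite mulrC mulr_natr -lnXn; last lra.
  by rewrite ler_ln ?posrE; nra.
have lnN0 : 0 <= ln (N + 1) / ln 2.
  by rewrite divr_ge0 ?(ltW ln2) // ln_ge0 //; lra.
have [d1 d2] : ln (N + 1) / ln 2 <= d%:R /\ d%:R <= ln (N + 1) / ln 2 + 1.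
  have /andP[h1 h2] := truncn_itv lnN0.
  by split; [exact: ltW | rewrite /d -natr1; lra].
have Nd : N + 1 <= 2 ^+ d.
  rewrite -ler_ln ?posrE ?exprn_gt0 //; last lra.
  by rewrite lnXn // -[leRHS]mulr_natl -ler_pdivrMr.
have k0 : (0 < k)%N by [].
clearbody k d.
exists (segmented_query k d (-1) N (-1) N) => J succ hJ hs; split; last first.
  move=> I _.
  have := probes_segmented_query succ k d (-1) N (-1) N I.
  rewrite -(ler_nat R) => /le_trans; apply.
  rewrite natrD natrM -natr1 -mul2n natrM.
  rewrite (_ : _ * (ln N / eps) = 10 * ((ln N / ln 2) * ((1 + E) * eps^-1)));
    last by field; lra.
  have L1 : 1 <= ln N / ln 2 by rewrite ler_pdivlMr // mul1r.
  have L2 : ln (N + 1) / ln 2 <= 2 * (ln N / ln 2).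
    by rewrite mulrA ler_pM2r ?invr_gt0.
  have M1 : k%:R <= (1 + E) * eps^-1.
    have : 1 <= E * eps^-1 by rewrite ler_pdivlMr ?mul1r.
    by lra.
  have kR : 1 <= k%:R :> R by rewrite ler1n.
  have h1 : d%:R * k%:R <= 3 * (ln N / ln 2) * ((1 + E) * eps^-1).
    by apply: ler_pM => //; lra.
  have h2 : 1 * k%:R <= (ln N / ln 2) * ((1 + E) * eps^-1).
    by apply: ler_pM => //; lra.
  by lra.
have sJ := segmented_sub _ _ hs k d (-1) N (-1) N.
have ns := segmented_pairwise _ _ _ hJ hs k d (-1) N (-1) N k0.
have us := segmented_uniq _ _ _ hJ hs k d (-1) N (-1) N k0.
set s := segmented succ k d (-1) N (-1) N in sJ ns us *.
exists [fset i in s]%fset; last first.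
  by move=> I IJ; rewrite inE (answer_segmented_query _ _ _ hJ hs).
split.
- by apply/fsubsetP => i; rewrite inE => /sJ.
- exact/pairwise_feasible/before_non_overlapping.
rewrite card_fseq undup_id //.
(* The floor quotient leaves the maximum [opt J] alone on the left, so each feasible [S] can be
   bounded separately. *)
have hopt : (opt J <= (k.+1 * size s) %/ k)%N.
  apply/bigmax_leqP_seq => S; rewrite fpowersetE => /fsubsetP SJ.
  move=> /feasible_pairwise nS; rewrite leq_divRL // mulnC.
  have Nd' : N - -1 <= 2 ^+ d by rewrite opprK.
  have [h _] := segmented_approx _ _ _ hJ hs k d (-1) N (-1) N S k0 SJ nS
    (greedy_self_lt _ _ _ hJ hs _ _ k0) (greedy_self_lt _ _ _ hJ hs _ _ k0) Nd'.
  apply: leq_trans h; rewrite leq_mul //.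
  suff: all (inside (-1) N) S by rewrite all_count => /eqP ->.
  by apply/allP => i /SJ/hJ[h1 _ h2]; rewrite /inside h2 andbT; lra.
move: hopt; rewrite leq_divRL // -(ler_nat R) !natrM -natr1 => hopt.
rewrite mulrC ler_pdivrMr; last lra.
have kR : 0 < k%:R :> R by rewrite ltr0n.
rewrite -(ler_pM2r kR) (le_trans hopt) // -mulrA mulrC ler_wpM2l //.
have : 1 <= eps * k%:R by rewrite mulrC -ler_pdivrMr // mul1r.
by lra.
Qed.
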